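(* Let $n\geq 3$ be a natural number, and let $\mathfrak{P}_n$ be the kernel of the canonical group homomorphism $\alpha:PS_n\to S_n$, $\alpha(\sigma_i)=s_i$ for $1\leq i\leq n-1$. Then $\mathfrak{P}_n$ is an abelian group.
   Context: For $n\geq 3$, the pseudosymmetric group $PS_n$ is the group with generators $\sigma_i$, $1\leq i\leq n-1$, and relations $\sigma_i\sigma_j=\sigma_j\sigma_i$ if $|i-j|\geq 2$, $\sigma_i\sigma_{i+1}\sigma_i=\sigma_{i+1}\sigma_i\sigma_{i+1}$ for $1\leq i\leq n-2$, and $\sigma_i\sigma_{i+1}^{-1}\sigma_i=\sigma_{i+1}\sigma_i^{-1}\sigma_{i+1}$ for $1\leq i\leq n-2$ (the last family may equivalently be replaced by $\sigma_i^2\sigma_{i+1}^2=\sigma_{i+1}^2\sigma_i^2$ for $1\leq i\leq n-2$). $S_n$ is the symmetric group, with standard generators the transpositions $s_i=(i,i+1)$. *)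

(* Defs.v *)
From HB Require Import structures.
From mathcomp Require Import all_boot all_fingroup.
From mathcomp Require Import generic_quotient.
From mathcomp Require Import boolp.

Set Implicit Arguments.
Unset Strict Implicit.
Unset Printing Implicit Defensive.

Local Open Scope quotient_scope.
Local Open Scope group_scope.

Section Presentation.
Variable I : choiceType.

(* The letter (i, false) stands for the generator i, (i, true) for its formal
   inverse. *)
Definition word : Type := seq (I * bool).
Definition pos (i : I) : I * bool := (i, false).
Definition neg (i : I) : I * bool := (i, true).
Definition inv_letter (a : I * bool) : I * bool := (a.1, ~~ a.2).
Definition inv_word (w : word) : word := rev (map inv_letter w).

Inductive word_eq (R : word -> word -> Prop) : word -> word -> Prop :=
| word_eq_refl u : word_eq R u u
| word_eq_sym u v : word_eq R u v -> word_eq R v u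
| word_eq_trans v u w : word_eq R u v -> word_eq R v w -> word_eq R u w
| word_eq_cat u u' v v' :
    word_eq R u u' -> word_eq R v v' -> word_eq R (u ++ v) (u' ++ v')
| word_eq_cancel a : word_eq R [:: a; inv_letter a] [::]
| word_eq_rel u v : R u v -> word_eq R u v.

Variable R : word -> word -> Prop.

Definition word_eqb : rel (seq (I * bool)) := fun u v => `[< word_eq R u v >].

Lemma word_eqb_refl : reflexive word_eqb.
Proof. by move=> u; apply/asboolP; exact: word_eq_refl. Qed.

Lemma word_eqb_sym : symmetric word_eqb.
Proof. by move=> u v; apply/asboolP/asboolP; exact: word_eq_sym. Qed.

Lemma word_eqb_trans : transitive word_eqb.
Proof.
by move=> v u w /asboolP uv /asboolP vw; apply/asboolP; apply: word_eq_trans vw.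
Qed.

Canonical word_equiv := EquivRel word_eqb
  word_eqb_refl word_eqb_sym word_eqb_trans.

(* The group with generators I and relations u = v for R u v. *)
Definition presented : Type := {eq_quot word_equiv}.
HB.instance Definition _ := Choice.on presented.
HB.instance Definition _ := EqQuotient.on presented.

Definition wclass (w : word) : presented := \pi_presented%qT w.

Lemma wclassP u v : wclass u = wclass v <-> word_eq R u v.
Proof. by split=> [/eqmodP/asboolP // | uv]; apply/eqmodP/asboolP. Qed.

Lemma wclass_repr x : wclass (repr x) = x.
Proof. exact: reprK. Qed.

Lemma inv_wordK : involutive inv_word.
Proof.
move=> w; rewrite /inv_word map_rev revK -map_comp map_id_in // => -[i b] _.
by rewrite /= /inv_letter /= negbK.
Qed.

Lemma word_eq_mulV w : word_eq R (w ++ inv_word w) [::].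
Proof.
elim: w => [|a w IHw]; first exact: word_eq_refl.
rewrite /inv_word /= rev_cons -cats1 -cat1s.
apply: word_eq_trans (word_eq_cancel R a).
rewrite -[X in word_eq R _ X]cat1s.
apply: word_eq_cat; first exact: word_eq_refl.
rewrite catA -[X in word_eq R _ X]cat0s.
by apply: word_eq_cat => //; exact: word_eq_refl.
Qed.

Lemma word_eq_Vmul w : word_eq R (inv_word w ++ w) [::].
Proof. by rewrite -{2}[w]inv_wordK; exact: word_eq_mulV. Qed.

Lemma word_eq_inv u v : word_eq R u v -> word_eq R (inv_word u) (inv_word v).
Proof.
move=> uv; apply: (@word_eq_trans _ (inv_word u ++ (v ++ inv_word v))).
  apply: word_eq_sym; rewrite -[X in word_eq R _ X]cats0.
  by apply: word_eq_cat; [exact: word_eq_refl | exact: word_eq_mulV].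
rewrite catA -[X in word_eq R _ X]cat0s.
apply: word_eq_cat; last exact: word_eq_refl.
apply: word_eq_trans (word_eq_Vmul u).
apply: word_eq_cat; first exact: word_eq_refl.
exact: word_eq_sym.
Qed.

Definition pres_mul (x y : presented) : presented :=
  wclass (repr x ++ repr y).
Definition pres_one : presented := wclass [::].
Definition pres_inv (x : presented) : presented := wclass (inv_word (repr x)).

Lemma repr_wclass w : word_eq R (repr (wclass w)) w.
Proof. by apply/wclassP; rewrite wclass_repr. Qed.

Lemma pres_mulE u v : pres_mul (wclass u) (wclass v) = wclass (u ++ v).
Proof. by apply/wclassP; apply: word_eq_cat; exact: repr_wclass. Qed.

Lemma pres_invE u : pres_inv (wclass u) = wclass (inv_word u).
Proof. by apply/wclassP; apply: word_eq_inv; exact: repr_wclass. Qed.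

Lemma pres_mulA : associative pres_mul.
Proof.
move=> x y z; rewrite -[x]wclass_repr -[y]wclass_repr -[z]wclass_repr.
by rewrite !pres_mulE catA.
Qed.

Lemma pres_mul1 : left_id pres_one pres_mul.
Proof. by move=> x; rewrite -[x]wclass_repr pres_mulE cat0s. Qed.

Lemma pres_mulx1 : right_id pres_one pres_mul.
Proof. by move=> x; rewrite -[x]wclass_repr pres_mulE cats0. Qed.

Lemma pres_mulV : right_inverse pres_one pres_inv pres_mul.
Proof.
move=> x; rewrite -[x]wclass_repr pres_invE pres_mulE.
exact/wclassP/word_eq_mulV.
Qed.

Lemma pres_Vmul : left_inverse pres_one pres_inv pres_mul.
Proof.
move=> x; rewrite -[x]wclass_repr pres_invE pres_mulE.
exact/wclassP/word_eq_Vmul.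
Qed.

HB.instance Definition _ := isGroup.Build presented
  pres_mulA pres_mul1 pres_mulx1 pres_Vmul pres_mulV.

Definition pres_gen (i : I) : presented := wclass [:: pos i].

Lemma wclass_cat u v : wclass (u ++ v) = wclass u * wclass v.
Proof. by rewrite [RHS]pres_mulE. Qed.

Lemma wclass_nil : wclass [::] = 1.
Proof. by []. Qed.

Lemma wclass_pos i : wclass [:: pos i] = pres_gen i.
Proof. by []. Qed.

Lemma wclass_neg i : wclass [:: neg i] = (pres_gen i)^-1.
Proof. by rewrite [RHS]pres_invE. Qed.

Lemma wclass_prod (w : word) :
  wclass w =
    \prod_(a <- w) (if a.2 then (pres_gen a.1)^-1 else pres_gen a.1).
Proof.
elim: w => [|[i b] w IHw]; first by rewrite big_nil.
by rewrite big_cons -cat1s wclass_cat IHw; case: b; rewrite /= -?wclass_neg.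
Qed.

End Presentation.

Definition word_eval (I : choiceType) (H : groupType) (f : I -> H)
    (w : word I) : H :=
  \prod_(a <- w) (if a.2 then (f a.1)^-1 else f a.1).

Definition satisfies (I : choiceType) (R : word I -> word I -> Prop)
    (H : groupType) (f : I -> H) : Prop :=
  forall u v, R u v -> word_eval f u = word_eval f v.

Lemma pres_gen_satisfies (I : choiceType) (R : word I -> word I -> Prop) :
  satisfies R (pres_gen R).
Proof.
move=> u v uv; rewrite /word_eval -!wclass_prod.
exact/wclassP/word_eq_rel.
Qed.

Section Lift.
Variables (I : choiceType) (R : word I -> word I -> Prop).
Variables (H : groupType) (f : I -> H).
Hypothesis fR : satisfies R f.

Lemma word_eval_cat u v : word_eval f (u ++ v) = word_eval f u * word_eval f v.
Proof. by rewrite /word_eval big_cat. Qed.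

Lemma word_eval_eq u v : word_eq R u v -> word_eval f u = word_eval f v.
Proof.
elim=> {u v} [u|u v _|u v w _ -> _ ->|u u' v v' _ eu _ ev|[i b]|u v /fR] //.
  by rewrite !word_eval_cat eu ev.
by rewrite /word_eval !big_cons big_nil mulg1; case: b; rewrite /= ?(mulVg, mulgV).
Qed.

(* The homomorphism sending each generator i to f i. *)
Definition pres_lift of satisfies R f : presented R -> H :=
  fun x => word_eval f (repr x).

Lemma pres_lift_wclass w : pres_lift fR (wclass R w) = word_eval f w.
Proof. by apply: word_eval_eq; exact: repr_wclass. Qed.

Lemma pres_lift_gen i : pres_lift fR (pres_gen R i) = f i.
Proof. by rewrite pres_lift_wclass /word_eval big_cons big_nil mulg1. Qed.

Lemma pres_lift_morphism : monoid_morphism (pres_lift fR).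
Proof.
split; first by rewrite -wclass_nil pres_lift_wclass /word_eval big_nil.
move=> x y; rewrite -[x]wclass_repr -[y]wclass_repr -wclass_cat.
by rewrite !pres_lift_wclass word_eval_cat.
Qed.

HB.instance Definition _ :=
  isUMagmaMorphism.Build (presented R) H (pres_lift fR) pres_lift_morphism.

Lemma pres_lift_unique (g : UMagmaMorphism.type (presented R) H) :
  (forall i, g (pres_gen R i) = f i) -> g =1 pres_lift fR.
Proof.
move=> gf x; rewrite -[x]wclass_repr pres_lift_wclass wclass_prod gmulf_prod.
by apply: eq_bigr => -[i b] _; case: b; rewrite /= ?gmulfV gf.
Qed.

End Lift.

Section Kernel.
Variables (G H : groupType) (f : UMagmaMorphism.type G H).

Definition gker : {pred G} := [pred x | f x == 1].

Lemma gkerP x : reflect (f x = 1) (x \in gker).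
Proof. exact: eqP. Qed.

Lemma gker_group_closed : group_closed gker.
Proof.
split; first by apply/gkerP; exact: gmulf1.
by move=> x y /gkerP fx /gkerP fy; apply/gkerP; rewrite gmulfF fx fy divg1.
Qed.

Record kernel : Type := Kernel { kernel_val : G; _ : kernel_val \in gker }.

HB.instance Definition _ := [isSub for kernel_val].
HB.instance Definition _ := [Choice of kernel by <:].
HB.instance Definition _ :=
  SubChoice_isSubGroup.Build G gker kernel gker_group_closed.

End Kernel.

Definition abelian_group (G : groupType) : Prop :=
  forall x y : G, x * y = y * x.

(* The generators of PS_n are indexed from 0: i : 'I_n.-1 stands for
   sigma_(i + 1). *)
Inductive ps_rel (n : nat) : word 'I_n.-1 -> word 'I_n.-1 -> Prop :=
| ps_comm (i j : 'I_n.-1) : (i + 2 <= j)%N || (j + 2 <= i)%N ->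
    ps_rel [:: pos i; pos j] [:: pos j; pos i]
| ps_braid (i j : 'I_n.-1) : j = (i + 1)%N :> nat ->
    ps_rel [:: pos i; pos j; pos i] [:: pos j; pos i; pos j]
| ps_pseudo (i j : 'I_n.-1) : j = (i + 1)%N :> nat ->
    ps_rel [:: pos i; neg j; pos i] [:: pos j; neg i; pos j].

Definition PS (n : nat) : groupType := presented (@ps_rel n).

Definition sigma (n : nat) (i : 'I_n.-1) : PS n := pres_gen (@ps_rel n) i.

Lemma sigma_comm (n : nat) (i j : 'I_n.-1) :
  (i + 2 <= j)%N || (j + 2 <= i)%N -> sigma i * sigma j = sigma j * sigma i.
Proof.
by move=> /ps_comm/pres_gen_satisfies; rewrite /word_eval !big_cons big_nil /= !mulg1.
Qed.

Lemma sigma_braid (n : nat) (i j : 'I_n.-1) : j = (i + 1)%N :> nat ->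
  sigma i * sigma j * sigma i = sigma j * sigma i * sigma j.
Proof.
move=> /ps_braid/pres_gen_satisfies.
by rewrite /word_eval !big_cons big_nil /= !mulg1 !mulgA.
Qed.

Lemma sigma_pseudo (n : nat) (i j : 'I_n.-1) : j = (i + 1)%N :> nat ->
  sigma i * (sigma j)^-1 * sigma i = sigma j * (sigma i)^-1 * sigma j.
Proof.
move=> /ps_pseudo/pres_gen_satisfies.
by rewrite /word_eval !big_cons big_nil /= !mulg1 !mulgA.
Qed.

Lemma lt_adj (n : nat) (i : 'I_n.-1) : (i < n)%N /\ (i.+1 < n)%N.
Proof. by case: n i => [[]//|n] [i /= lt_in]; rewrite !ltnS (ltnW lt_in). Qed.

Definition adj_transp (n : nat) (i : 'I_n.-1) : 'S_n :=
  tperm (Ordinal (lt_adj i).1) (Ordinal (lt_adj i).2).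

Lemma adj_transp_satisfies (n : nat) :
  satisfies (@ps_rel n) (@adj_transp n).
Proof.
have tB (a b c : 'I_n) : a != b -> b != c -> a != c ->
    tperm a b * (tperm b c * tperm a b) = tperm b c * (tperm a b * tperm b c).
  move=> ab bc ac.
  have -> : tperm a b * (tperm b c * tperm a b) = tperm b c ^ tperm a b.
    by rewrite /conjg tpermV.
  have -> : tperm b c * (tperm a b * tperm b c) = tperm a b ^ tperm b c.
    by rewrite /conjg tpermV.
  by rewrite !tpermJ tpermR tpermL !tpermD // eq_sym.
have sB (i j : 'I_n.-1) : j = (i + 1)%N :> nat ->
    adj_transp i * (adj_transp j * adj_transp i) =
    adj_transp j * (adj_transp i * adj_transp j).
  move=> ji; rewrite /adj_transp.
  have -> : Ordinal (lt_adj j).1 = Ordinal (lt_adj i).2.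
    by apply: val_inj; rewrite /= ji addn1.
  by apply: tB; rewrite -val_eqE /= ?ji ?addn1 neq_ltn ?ltnS ?leqnn ?leqnSn.
move=> u v [i j ij|i j ji|i j ji];
  rewrite /word_eval !big_cons big_nil /= !mulg1; last 2 first.
- exact: sB.
- by rewrite /adj_transp !tpermV; exact: sB.
wlog ij2 : i j {ij} / (i.+1 < j)%N.
  by case/orP: ij; rewrite addn2 => ij wl; [|symmetry]; exact: wl.
have ij1 := ltnW ij2; have ij0 := ltnW ij1.
apply/commgP/conjg_fixP; rewrite /adj_transp tpermJ.
by rewrite !tpermD // -val_eqE /= neq_ltn ?ltnS ?ij0 ?ij1 ?ij2 orbT.
Qed.

Definition alpha (n : nat) : UMagmaMorphism.type (PS n) 'S_n :=
  pres_lift (@adj_transp_satisfies n).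

Lemma alpha_sigma (n : nat) (i : 'I_n.-1) : alpha n (sigma i) = adj_transp i.
Proof. exact: pres_lift_gen. Qed.

Definition PSker (n : nat) : groupType := kernel (alpha n).

(* Main.v *)
Require Import Defs.
From mathcomp Require Import all_boot all_fingroup.
From mathcomp Require Import zify.

(** The squares of the generators of [PS n] lie in the kernel of [alpha], and
    two facts about them carry the proof.

    The first is that the conjugates of the squares commute with one another.
    As in the pure braid group, there is one conjugate [band i d] for each pair
    [i < j = i + d + 1] of strands; it is obtained from the square of the
    generator [i] by conjugation with the generators [i + 1, ..., j - 1].  In
    the pseudosymmetric group, squares of adjacent generators commute, and this
    makes conjugation by the generator [k] act on these elements exactly as the
    transposition [(k, k + 1)] acts on pairs ([band_swap]).  This action is an
    involution, so that the elements [band i d] exhaust the conjugates of the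
    squares and each of them commutes with all the squares of the generators
    ([square_commJ]).

    The second is that the kernel is contained in every normal subgroup [N]
    between the squares and the kernel ([ker_sub_normal]); in other words, the
    symmetric group is the quotient by the squares.  Modulo [N], the inverses
    of the generators are superfluous, and every product of the generators
    [0, ..., m] is a product of the generators [0, ..., m - 1] times a
    descending product [s m * s (m - 1) * ... * s j] ([reachS]).  In the
    symmetric group this product moves the point [m + 1] to [j], whereas the
    other factor fixes [m + 1]; for an element of the kernel the descending
    product must therefore be trivial, and one concludes by induction on [m].

    It remains to use the second fact twice, with centralizers for [N].  By the
    first fact, the elements of the kernel that commute with all conjugates of
    squares form a subgroup containing the squares, hence the whole kernel.  So
    the squares are central in the kernel; the centre of the kernel being
    normal, it is again the whole kernel. *)

Set Implicit Arguments.
Unset Strict Implicit.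
Unset Printing Implicit Defensive.

Local Open Scope group_scope.

(** * Normal subgroups of an arbitrary group *)

Section NormalSubgroups.
Variable G : groupType.
Implicit Types (N P : G -> Prop) (x y : G).

Definition normal_subgroup N : Prop :=
  [/\ N 1, forall x y, N x -> N y -> N (x * y),
      forall x, N x -> N x^-1 & forall x y, N x -> N (x ^ y)].

Lemma normal_subgroupI N P : normal_subgroup N -> normal_subgroup P ->
  normal_subgroup (fun x => N x /\ P x).
Proof.
move=> [N1 NM NV NJ] [P1 PM PV PJ]; split=> //.
- by move=> x y [Nx Px] [Ny Py]; split; [exact: NM | exact: PM].
- by move=> x [Nx Px]; split; [exact: NV | exact: PV].
- by move=> x y [Nx Px]; split; [exact: NJ | exact: PJ].
Qed.

Lemma normal_subgroup_ker (H : groupType) (f : UMagmaMorphism.type G H) :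
  normal_subgroup (fun x => f x = 1).
Proof.
split=> [|x y fx fy|x fx|x y fx]; first exact: gmulf1.
- by rewrite gmulfM fx fy mulg1.
- by rewrite gmulfV fx invg1.
- by rewrite gmulfJ fx conj1g.
Qed.

Lemma normal_subgroup_cent P : (forall x y, P x -> P (x ^ y)) ->
  normal_subgroup (fun x => forall y, P y -> commute x y).
Proof.
move=> PJ; split=> [y _|x y Cx Cy z Pz|x Cx z Pz|x y Cx z Pz].
- exact/commute_sym/commute1.
- by apply/commute_sym/commuteM; apply/commute_sym; [exact: Cx | exact: Cy].
- exact/commute_sym/commuteV/commute_sym/Cx.
- rewrite -[z](conjgKV y) /commute -!conjMg; congr (_ ^ y).
  exact/Cx/PJ.
Qed.

End NormalSubgroups.

(** * Conjugation of the squares of the generators *)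

Section Conjugation.
Variable G : groupType.
Implicit Types a b x : G.

Lemma commute_conj x y : commute x y -> x ^ y = x.
Proof. by move=> xy; apply/conjg_fixP/commgP. Qed.

Lemma conj_commute x y : x ^ y = x -> commute x y.
Proof. by move=> xy; apply/commgP/conjg_fixP. Qed.

Lemma conjg_swap x a b : commute a b -> (x ^ a) ^ b = (x ^ b) ^ a.
Proof. by move=> ab; rewrite -!conjgM ab. Qed.

Lemma square_comm a b : a * b * a = b * a * b ->
  a * b^-1 * a = b * a^-1 * b -> commute (a ^+ 2) (b ^+ 2).
Proof.
move=> bra pse; rewrite /commute !expg2.
(* This is the pseudosymmetric relation times the braid relation. *)
have -> : a * a * (b * b) = a * b^-1 * a * (b * a * b).
  rewrite -[RHS]mulgA [a * (b * a * b)]mulgA [a * (b * a)]mulgA.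
  by rewrite bra !mulgA mulgVK.
rewrite pse -bra.
rewrite -[LHS]mulgA [b * (a * b * a)]mulgA [b * (a * b)]mulgA.
by rewrite -bra !mulgA mulgVK.
Qed.

Lemma braid_conj a b : a * b * a = b * a * b -> (a ^ b) ^ a = b.
Proof. by move=> bra; rewrite -conjgM conjgE [a * (b * a)]mulgA bra mulKg. Qed.

End Conjugation.

Section PseudoBraids.
Variables (G : groupType) (n : nat) (s : nat -> G).
Hypothesis s_comm : forall i j, i.+1 < j -> s i * s j = s j * s i.
Hypothesis s_braid : forall i, i.+2 < n ->
  s i * s i.+1 * s i = s i.+1 * s i * s i.+1.
Hypothesis s_pseudo : forall i, i.+2 < n ->
  s i * (s i.+1)^-1 * s i = s i.+1 * (s i)^-1 * s i.+1.

Lemma far_commute i j : (i.+1 < j) || (j.+1 < i) -> commute (s i) (s j).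
Proof. by case/orP=> ij; [|apply: commute_sym]; exact: s_comm. Qed.

(** The pure braid generator that twists the strands [i] and [i + d + 1]. *)
Fixpoint band i d : G :=
  if d is d'.+1 then band i d' ^ s (i + d').+1 else s i ^+ 2.

Lemma band_far i d k : (k.+1 < i) || (i + d.+1 < k) ->
  band i d ^ s k = band i d.
Proof.
elim: d => [|d IHd] far /=.
  rewrite conjXg (commute_conj (far_commute _)) //; lia.
by rewrite conjg_swap ?IHd //; [lia | apply: far_commute; lia].
Qed.

Lemma band_inside i d k : (i + d).+1 < n -> i < k < i + d ->
  band i d ^ s k = band i d.
Proof.
elim: d => [|d IHd] lt_n ik; first lia.
have [lt_k|le_k] := ltnP k (i + d).
  rewrite /= conjg_swap ?IHd //; [lia | lia | apply: far_commute; lia].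
case: d => [|d] in IHd lt_n ik le_k *; first lia.
have -> : k = (i + d).+1 by lia.
rewrite /= addnS -!conjgM mulgA s_braid ?conjgM; last lia.
by rewrite band_far //; lia.
Qed.

(** Equivalently, the square of the generator [i + d + 1] fixes [band i d]; in
    the braid group, where adjacent squares do not commute, it does not. *)
Lemma band_shrink i d : (i + d).+2 < n ->
  band i d.+1 ^ s (i + d).+1 = band i d.
Proof.
elim: d => [|d IHd] lt_n.
  rewrite /= addn0 -conjgM -expg2; apply: commute_conj.
  by rewrite addn0 in lt_n; exact: square_comm (s_braid lt_n) (s_pseudo lt_n).
have bra : s (i + d).+2 * s (i + d).+1 * s (i + d).+2 =
    s (i + d).+1 * s (i + d).+2 * s (i + d).+1.
  by rewrite s_braid //; lia.
have far : band i d ^ s (i + d).+2 = band i d by apply: band_far; lia.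
rewrite [LHS]/= addnS.
(* With a, b for the last two generators, a b b = b^-1 a a b a. *)
rewrite -{1}far -!conjgM !mulgA bra -!mulgA.
rewrite [s (i + d).+2 * (_ * _)]mulgA bra !mulgA !conjgM.
rewrite -[band i d ^ s _]/(band i d.+1) IHd ?far //; lia.
Qed.

Lemma band_left i d : (i + d).+2 < n ->
  band i d.+1 ^ s i = band i.+1 d /\ band i.+1 d ^ s i = band i d.+1.
Proof.
elim: d => [|d IHd] lt_n; last first.
  have [] := IHd ltac:(lia) => le ri.
  have far : commute (s i) (s (i + d).+2) by apply: far_commute; lia.
  split; rewrite [band i _]/= [band i.+1 _]/= addSn addnS.
    by rewrite -[X in (X ^ _) ^ _]/(band i d.+1) conjg_swap ?le.
  by rewrite conjg_swap ?ri.
rewrite addn0 in lt_n; have bra := s_braid lt_n.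
have sq := square_comm bra (s_pseudo lt_n).
rewrite /= addn0; split; first by rewrite !conjXg braid_conj.
apply: (@conjg_inj _ (s i.+1)).
by rewrite -[RHS]conjgM -expg2 (commute_conj sq) !conjXg braid_conj.
Qed.

(** The pair [i'], [i' + d' + 1] is the image of [i], [i + d + 1] under the
    transposition [(k, k + 1)].  The second equation makes the action an
    involution: it handles conjugation by inverses of generators and shows that
    squares of generators act trivially. *)
Lemma band_swap i d k : (i + d).+1 < n -> k.+1 < n ->
  exists i' d', [/\ (i' + d').+1 < n, band i d ^ s k = band i' d'
                  & band i' d' ^ s k = band i d].
Proof.
move=> lt_n lt_k.
have fixed : band i d ^ s k = band i d -> exists i' d',
    [/\ (i' + d').+1 < n, band i d ^ s k = band i' d'
     & band i' d' ^ s k = band i d] by exists i, d.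
have /or4P[lt_ki|/eqP ki|/eqP ik|lt_ik] :
  [|| k.+1 < i, k.+1 == i, k == i | i < k] by lia.
- by apply/fixed/band_far; rewrite lt_ki.
- subst i; have [] := @band_left k d ltac:(lia) => le ri.
  by exists k, d.+1; split=> //; lia.
- subst k; case: d => [|d] in lt_n fixed *.
    by apply: fixed; rewrite /= conjXg commute_conj.
  have [] := @band_left i d ltac:(lia) => le ri.
  by exists i.+1, d; split=> //; lia.
have /or4P[lt_kd|/eqP kd|/eqP kd|lt_dk] :
  [|| k < i + d, k == i + d, k == (i + d).+1 | i + d.+1 < k] by lia.
- by apply/fixed/band_inside=> //; rewrite lt_ik.
- case: d => [|d] in lt_n fixed kd *; first lia.
  rewrite addnS in kd lt_n; subst k.
  by exists i, d; rewrite band_shrink //; split=> //; lia.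
- subst k; exists i, d.+1; rewrite band_shrink //; split=> //; lia.
- by apply/fixed/band_far; rewrite lt_dk orbT.
Qed.

Hypothesis s_gen : forall P : G -> Prop, P 1 ->
  (forall x k, k.+1 < n -> P x -> P (x * s k)) ->
  (forall x k, k.+1 < n -> P x -> P (x * (s k)^-1)) -> forall x, P x.

Lemma square_commJ k l g h : k.+1 < n -> l.+1 < n ->
  commute ((s k ^+ 2) ^ g) ((s l ^+ 2) ^ h).
Proof.
move=> lt_k lt_l.
pose is_band x := exists i d, (i + d).+1 < n /\ x = band i d.
have bandJ : forall u, is_band ((s k ^+ 2) ^ u).
  elim/s_gen=> [|u j lt_j [i [d [lt_n ukE]]]|u j lt_j [i [d [lt_n ukE]]]].
  - by exists k, 0; rewrite conjg1 addn0.
  - have [i' [d' [lt_n' eq' _]]] := band_swap lt_n lt_j.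
    by exists i', d'; rewrite conjgM ukE.
  - have [i' [d' [lt_n' _ eq']]] := band_swap lt_n lt_j.
    by exists i', d'; rewrite conjgM ukE -eq' conjgK.
rewrite -[(s k ^+ 2) ^ g](conjgKV h) /commute -!conjMg; congr (_ ^ h).
rewrite -conjgM; have [i [d [lt_n ->]]] := bandJ (g * h^-1).
have [i' [d' [_ eq eq']]] := band_swap lt_n lt_l.
by apply: conj_commute; rewrite expg2 conjgM eq eq'.
Qed.

(** * The symmetric group as the quotient by the squares *)

Variable f : UMagmaMorphism.type G 'S_n.
Hypothesis f_sq : forall k, k.+1 < n -> f (s k ^+ 2) = 1.
Hypothesis f_fix : forall k (x : 'I_n), k.+1 < n -> k.+1 < x -> f (s k) x = x.
Hypothesis f_step : forall k (x : 'I_n), x = k.+1 :> nat ->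
  f (s k) x = k :> nat.

(** The products [s m * s (m - 1) * ... * s j], with [j = m + 1 - l], represent
    the cosets of the permutations that fix [m + 1] among those that fix every
    point above [m + 1]. *)
Fixpoint descent m l : G :=
  if l is l'.+1 then descent m l' * s (m - l') else 1.

Lemma descent_far m l k : l <= m.+1 -> k.+1 < m.+1 - l ->
  descent m l * s k = s k * descent m l.
Proof.
elim: l => [|l IHl] le_l lt_k /=; first by rewrite mulg1 mul1g.
have far : commute (s (m - l)) (s k) by apply: far_commute; lia.
by rewrite -mulgA far !mulgA IHl //; lia.
Qed.

Lemma descent_shift m l k : m.+1 < n -> l <= m.+1 -> m.+1 - l < k <= m ->
  descent m l * s k = s k.-1 * descent m l.
Proof.
move=> lt_m; elim: l => [|l IHl] le_l lt_k /=; first lia.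
have [lt_lk|le_kl] := ltnP (m.+1 - l) k.
  have far : commute (s (m - l)) (s k) by apply: far_commute; lia.
  by rewrite -mulgA far !mulgA IHl //; lia.
case: l => [|l] in IHl le_l lt_k le_kl *; first lia.
have -> : k = (m - l.+1).+1 by lia.
rewrite [_.-1]/= [descent m l.+1]/=.
have -> : m - l = (m - l.+1).+1 by lia.
have bra : s (m - l.+1) * s (m - l.+1).+1 * s (m - l.+1) =
    s (m - l.+1).+1 * s (m - l.+1) * s (m - l.+1).+1.
  by apply: s_braid; lia.
by rewrite -!mulgA [s _ * (s _ * s _)]mulgA -bra !mulgA descent_far //; lia.
Qed.

Lemma descent_perm m l (x : 'I_n) : x = m.+1 :> nat -> l <= m.+1 ->
  f (descent m l) x = m.+1 - l :> nat.
Proof.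
move=> xm; elim: l => [|l IHl] le_l; first by rewrite gmulf1 perm1 subn0.
rewrite /= gmulfM permM subSS; apply: f_step.
by rewrite IHl; lia.
Qed.

Section NormalSubgroupOverSquares.
Variable N : G -> Prop.
Hypothesis nN : normal_subgroup N.
Hypothesis N_sq : forall k, k.+1 < n -> N (s k ^+ 2).
Hypothesis fN : forall x, N x -> f x = 1.

(** The monoid generated by [s k] for [k < m], instead of the group, suffices
    here because [N] contains the squares. *)
Inductive reach m : G -> Prop :=
| reach_N x of N x : reach m x
| reach_mul x k of k < m & reach m x : reach m (x * s k).

Lemma reach_mulN m x y : N x -> reach m y -> reach m (x * y).
Proof.
have [_ NM _ _] := nN; move=> Nx; elim=> [z Nz|z k lt_k _ IHz].
  by apply: reach_N; exact: NM.
by rewrite mulgA; exact: reach_mul.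
Qed.

Lemma reach_all x : reach n.-1 x.
Proof.
have [N1 _ NV NJ] := nN.
elim/s_gen: x => [|x k lt_k rx|x k lt_k rx]; first exact: reach_N.
  by apply: reach_mul rx; lia.
have -> : x * (s k)^-1 = ((s k ^+ 2)^-1 ^ x^-1) * x * s k.
  by rewrite -conjgCV expg2 invgM !mulgA mulgVK.
apply: reach_mul; first lia.
by apply: reach_mulN rx; apply/NJ/NV/N_sq.
Qed.

(** Appending [s k] to [descent m l] lengthens it ([k = m - l]), shortens it up
    to a conjugate of a square ([k = m + 1 - l]), or can be moved to the left
    as [s k] or [s (k - 1)].  This is the coset decomposition that bounds the
    order of the Coxeter group by a factorial. *)
Lemma reachS m x : m.+1 < n -> reach m.+1 x ->
  exists h l, [/\ reach m h, l <= m.+1 & x = h * descent m l].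
Proof.
move=> lt_m; elim=> [{}x Nx|_ k lt_k _ [h [l [rh le_l ->]]]].
  by exists x, 0; rewrite mulg1; split=> //; exact: reach_N.
have /or4P[lt_kl|/eqP kl|/eqP kl|lt_lk] : [|| k.+1 < m.+1 - l, k.+1 == m.+1 - l,
    k == m.+1 - l | m.+1 - l < k] by lia.
- exists (h * s k), l; split=> //; first by apply: reach_mul rh; lia.
  by rewrite -!mulgA descent_far.
- exists h, l.+1; split=> //; first lia.
  by rewrite -mulgA; have -> : k = m - l by lia.
- case: l => [|l] in le_l kl *; first lia.
  exists (h * (s k ^+ 2) ^ (descent m l)^-1), l; split; last 2 first.
  + lia.
  + by rewrite -[RHS]mulgA -conjgCV [descent m l.+1]/= -subSS -kl expg2 !mulgA.
  have [_ _ _ NJ] := nN; rewrite conjgCV.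
  by apply: reach_mulN rh; apply/NJ/NJ/N_sq; lia.
- exists (h * s k.-1), l; split=> //; first by apply: reach_mul rh; lia.
  by rewrite -!mulgA descent_shift //; lia.
Qed.

Lemma reach_fix m h (x : 'I_n) : m < n -> reach m h -> m < x -> f h x = x.
Proof.
move=> lt_m rh lt_x; elim: rh => [y /fN ->|y k lt_k _ IHy]; first exact: perm1.
by rewrite gmulfM permM IHy f_fix //; lia.
Qed.

(** In a factorization [h * descent m l] of an element of the kernel, only [l]
    non-zero could move the point [m + 1]. *)
Lemma ker_sub_normal x : f x = 1 -> N x.
Proof.
have : (n.-1 < n) || (n.-1 == 0) by lia.
elim: n.-1 x (reach_all x) => [|m IHm] x rx lt_m fx1; first by case: rx.
rewrite orbF in lt_m; have [h [l [rh le_l xE]]] := reachS lt_m rx.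
have l0 : l = 0.
  have /(congr1 val) := congr1 (fun p : 'S_n => p (Ordinal lt_m)) fx1.
  rewrite perm1 xE gmulfM permM (reach_fix _ rh) //=; last lia.
  by rewrite descent_perm //; lia.
by rewrite xE l0 mulg1 in fx1 *; apply: IHm => //; lia.
Qed.

End NormalSubgroupOverSquares.

(** [ker_sub_normal] is applied first to the centralizer of all conjugates of
    squares, then to the centralizer of the kernel. *)
Lemma ker_abelian x y : f x = 1 -> f y = 1 -> commute x y.
Proof.
have nK := normal_subgroup_ker f; have [_ _ _ KJ] := nK.
have square_conj z u : (exists k h, k.+1 < n /\ z = (s k ^+ 2) ^ h) ->
    exists k h, k.+1 < n /\ z ^ u = (s k ^+ 2) ^ h.
  by move=> [k [h [lt_k ->]]]; exists k, (h * u); rewrite conjgM.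
have sq_central k z : k.+1 < n -> f z = 1 -> commute (s k ^+ 2) z.
  move=> lt_k fz; apply: commute_sym.
  have nN := normal_subgroupI nK (normal_subgroup_cent square_conj).
  have [| |_] := ker_sub_normal nN _ _ fz; last 1 first.
  - by apply; exists k, 1; rewrite conjg1.
  - move=> l lt_l; split=> [|w [j [h [lt_j ->]]]]; first exact: f_sq.
    by rewrite -[s l ^+ 2]conjg1; exact: square_commJ.
  - by move=> w [].
move=> fx; apply: (proj2 (ker_sub_normal (normal_subgroupI nK
  (normal_subgroup_cent KJ)) _ _ fx)) => [k lt_k | z []//].
by split=> [|z]; [exact: f_sq | exact: sq_central].
Qed.

End PseudoBraids.

(** * The pseudosymmetric group *)

(** The generators of [PS n], extended by [1] to all indices, so that products
    of generators are indexed by natural numbers. *)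
Definition gen n k : PS n := if insub k is Some i then sigma i else 1.

Lemma genE n k (lt_k : k < n.-1) : gen n k = sigma (Ordinal lt_k).
Proof. by rewrite /gen insubT. Qed.

Lemma gen_default n k : n.-1 <= k -> gen n k = 1.
Proof. by move=> le_k; rewrite /gen insubF // ltnNge le_k. Qed.

Lemma gen_comm n i j : i.+1 < j -> gen n i * gen n j = gen n j * gen n i.
Proof.
move=> lt_ij; have [lt_j|/gen_default->] := ltnP j n.-1; last exact: commute1.
have lt_i : i < n.-1 by lia.
by rewrite !genE; apply: sigma_comm; rewrite /= addn2 lt_ij.
Qed.

Lemma gen_braid n i : i.+2 < n ->
  gen n i * gen n i.+1 * gen n i = gen n i.+1 * gen n i * gen n i.+1.
Proof.
move=> lt_i; have [lt_i0 lt_i1] : i < n.-1 /\ i.+1 < n.-1 by lia.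
by rewrite !genE; apply: sigma_braid; rewrite /= addn1.
Qed.

Lemma gen_pseudo n i : i.+2 < n ->
  gen n i * (gen n i.+1)^-1 * gen n i = gen n i.+1 * (gen n i)^-1 * gen n i.+1.
Proof.
move=> lt_i; have [lt_i0 lt_i1] : i < n.-1 /\ i.+1 < n.-1 by lia.
by rewrite !genE; apply: sigma_pseudo; rewrite /= addn1.
Qed.

Lemma gen_ind n (P : PS n -> Prop) : P 1 ->
  (forall x k, k.+1 < n -> P x -> P (x * gen n k)) ->
  (forall x k, k.+1 < n -> P x -> P (x * (gen n k)^-1)) -> forall x, P x.
Proof.
move=> P1 PM PV x; rewrite -[x]wclass_repr; move: {x}(generic_quotient.repr x).
elim/last_ind=> [|w [i b] IHw]; first by rewrite wclass_nil.
have lt_i : i.+1 < n by case: (i) => /=; lia.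
have gi : gen n i = sigma i by rewrite /gen valK.
rewrite -cats1 wclass_cat.
by case: b; rewrite ?wclass_neg ?wclass_pos -/(sigma i) -gi;
  [exact: PV | exact: PM].
Qed.

Lemma alpha_gen n k (lt_k : k < n.-1) :
  alpha n (gen n k) = adj_transp (Ordinal lt_k).
Proof. by rewrite genE alpha_sigma. Qed.

Lemma alpha_gen_sq n k : k.+1 < n -> alpha n (gen n k ^+ 2) = 1.
Proof.
move=> lt_k; have lt_k' : k < n.-1 by lia.
by rewrite expg2 gmulfM alpha_gen tperm2.
Qed.

Lemma alpha_gen_fix n k (x : 'I_n) : k.+1 < n -> k.+1 < x ->
  alpha n (gen n k) x = x.
Proof.
move=> lt_k lt_x; have lt_k' : k < n.-1 by lia.
by rewrite alpha_gen tpermD // -val_eqE /=; lia.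
Qed.

Lemma alpha_gen_step n k (x : 'I_n) : x = k.+1 :> nat ->
  alpha n (gen n k) x = k :> nat.
Proof.
move=> xk; have lt_k : k < n.-1 by have := ltn_ord x; lia.
rewrite alpha_gen /adj_transp; set y := (X in tperm _ X).
by have -> : x = y by [apply: val_inj]; rewrite tpermR.
Qed.

Theorem proposition3p1 (n : nat) (hn : (3 <= n)%N) : abelian_group (PSker n).
Proof.
move=> x y; apply: val_inj; rewrite !gmulfM.
apply: (ker_abelian (@gen_comm n) (@gen_braid n) (@gen_pseudo n) (@gen_ind n)
  (@alpha_gen_sq n) (@alpha_gen_fix n) (@alpha_gen_step n)).
  exact/gkerP/(valP x).
exact/gkerP/(valP y).
Qed.
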